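(* Let $C$ be a simple point--line configuration in the plane $\mathbb{R}^2$. Then the sign pattern associated with $C$ has minimum rank $2$ if and only if the following three conditions hold: (i) $C$ contains at least $2$ points and at least $2$ lines; (ii) each point of $C$ lies on at most one line of $C$, and each line of $C$ passes through at most one point of $C$; and (iii) $C$ is equivalent to a simple point--line configuration $C_1$ all of whose lines are parallel to each other.
   Context: A sign pattern is a matrix with entries in $\{+,-,0\}$; for a real matrix $B$, $\operatorname{sgn}(B)$ replaces positive/negative/zero entries by $+,-,0$; $Q(\mathcal{A})=\{A\text{ real}:\operatorname{sgn}(A)=\mathcal{A}\}$; the minimum rank $\operatorname{mr}(\mathcal{A})$ is the minimum rank of a matrix in $Q(\mathcal{A})$. An $m$ point--$n$ line configuration $C$ in $\mathbb{R}^2$ consists of labeled points $p_1,\dots,p_m$ and labeled lines $l_1,\dots,l_n$. Each line is oriented: non-vertical lines point to the right (increasing $x$), vertical lines point upward. The sign pattern associated with $C$ is the $m\times n$ sign pattern $\mathcal{A}=[a_{ij}]$ with $a_{ij}=+$ if $p_i$ lies to the left of $l_j$ (i.e., above $l_j$ when $l_j$ is non-vertical), $a_{ij}=-$ if $p_i$ lies to the right of $l_j$ (below, when non-vertical), and $a_{ij}=0$ if $p_i$ lies on $l_j$. Two sign patterns $\mathcal{A}_1,\mathcal{A}_2$ are equivalent if $\mathcal{A}_2=P_1D_1\mathcal{A}_1D_2P_2$ for some permutation sign patterns $P_1,P_2$ (a square sign pattern with exactly one $+$ in each row and column and all other entries $0$) and signature sign patterns $D_1,D_2$ (square diagonal sign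 patterns with all diagonal entries nonzero). Two point--line configurations are equivalent if their associated sign patterns are equivalent. A point--line configuration $C$ is simple if: no two points of $C$ have identical or exactly opposite positions (above/below/on) relative to all lines of $C$; no two lines of $C$ have identical or exactly opposite positions relative to all points of $C$; no point of $C$ lies on all lines of $C$; and no line of $C$ passes through all points of $C$. *)

(* Defs.v *)
From HB Require Import structures.
From mathcomp Require Import all_boot all_order all_algebra.
From mathcomp Require Import boolp reals.

Set Implicit Arguments.
Unset Strict Implicit.
Unset Printing Implicit Defensive.
Import Order.TTheory GRing.Theory Num.Theory.
Local Open Scope ring_scope.

(* The signs +, -, 0 are the integers 1, -1, 0. *)
Definition is_sign : {pred int} := [pred x | x \in [:: 1; -1; 0]].

Record sign_pattern (m n : nat) := SignPattern {
  sp_mx :> 'M[int]_(m, n);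
  sp_mxP : sp_mx \is a mxOver is_sign }.

HB.instance Definition _ m n := [isSub for @sp_mx m n].

Fact sgn_subproof (R : realType) (m n : nat) (B : 'M[R]_(m, n)) :
  map_mx (@sgz R) B \is a mxOver is_sign.
Proof. by apply/mxOverP => i j; rewrite mxE; case: sgzP. Qed.

Definition sgn (R : realType) (m n : nat) (B : 'M[R]_(m, n)) :
  sign_pattern m n := SignPattern (sgn_subproof B).

Definition qual_class (R : realType) (m n : nat) (A : sign_pattern m n)
  (B : 'M[R]_(m, n)) : Prop := sgn B = A.

Definition rank_attained (R : realType) (m n : nat) (A : sign_pattern m n)
  : pred nat :=
  fun r => `[< exists B : 'M[R]_(m, n), qual_class A B /\ \rank B = r >].

Fact rank_attained_nonempty (R : realType) (m n : nat) (A : sign_pattern m n) :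
  exists r, rank_attained R A r.
Proof.
pose B : 'M[R]_(m, n) := map_mx intr (sp_mx A).
exists (\rank B); apply/asboolP; exists B; split=> //.
apply: val_inj; apply/matrixP => i j; rewrite !mxE.
have /mxOverP/(_ i j) := sp_mxP A.
rewrite !inE => /or3P[] /eqP ->; first by rewrite sgz1.
- by rewrite mulrN1z sgzN sgz1.
- by rewrite sgz0.
Qed.

Definition min_rank (R : realType) (m n : nat) (A : sign_pattern m n) : nat :=
  ex_minn (rank_attained_nonempty R A).

Definition permutation_pattern (n : nat) (P : sign_pattern n n) : Prop :=
  is_perm_mx (sp_mx P).

Definition signature_pattern (n : nat) (D : sign_pattern n n) : Prop :=
  is_diag_mx (sp_mx D) /\ forall i, D i i != 0.

(* Every entry of the product below has at most one nonzero summand, so the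
   integer matrix product is the product of sign patterns. *)
Definition sp_equiv (m n : nat) (A1 A2 : sign_pattern m n) : Prop :=
  exists (P1 D1 : sign_pattern m m) (D2 P2 : sign_pattern n n),
    [/\ permutation_pattern P1, signature_pattern D1,
        signature_pattern D2, permutation_pattern P2
      & sp_mx A2 = P1 *m D1 *m A1 *m D2 *m P2].

(* [NonVertical a b] is the line y = a x + b, [Vertical c] is the line x = c;
   every line of the plane has exactly one such representation. *)
Variant line (R : realType) :=
  | NonVertical (slope intercept : R)
  | Vertical (abscissa : R).

Definition on_line (R : realType) (l : line R) (p : R * R) : bool :=
  match l with
  | NonVertical a b => p.2 == a * p.1 + b
  | Vertical c => p.1 == c
  end.

(* Non-vertical lines point to the right and vertical lines point upward. *)
Definition left_of (R : realType) (l : line R) (p : R * R) : bool :=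
  match l with
  | NonVertical a b => a * p.1 + b < p.2
  | Vertical c => p.1 < c
  end.

Definition parallel (R : realType) (l1 l2 : line R) : Prop :=
  match l1, l2 with
  | NonVertical a1 _, NonVertical a2 _ => a1 = a2
  | Vertical _, Vertical _ => True
  | _, _ => False
  end.

Definition position (R : realType) (p : R * R) (l : line R) : int :=
  if on_line l p then 0 else if left_of l p then 1 else -1.

Record configuration (R : realType) (m n : nat) := Configuration {
  point : 'I_m -> R * R;
  cline : 'I_n -> line R }.

Definition pattern_mx (R : realType) (m n : nat) (C : configuration R m n) :
  'M[int]_(m, n) := \matrix_(i, j) position (point C i) (cline C j).

Fact pattern_subproof (R : realType) (m n : nat) (C : configuration R m n) :
  pattern_mx C \is a mxOver is_sign.
Proof.
by apply/mxOverP => i j; rewrite mxE /position; case: ifP => // _; case: ifP.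
Qed.

Definition pattern (R : realType) (m n : nat) (C : configuration R m n) :
  sign_pattern m n := SignPattern (pattern_subproof C).

Definition conf_equiv (R : realType) (m n : nat) (C1 C2 : configuration R m n)
  : Prop := sp_equiv (pattern C1) (pattern C2).

Definition simple_conf (R : realType) (m n : nat) (C : configuration R m n)
  : Prop :=
  [/\ forall i1 i2, i1 != i2 ->
        ~ (forall j, position (point C i1) (cline C j)
                   = position (point C i2) (cline C j)) /\
        ~ (forall j, position (point C i1) (cline C j)
                   = - position (point C i2) (cline C j)),
      forall j1 j2, j1 != j2 ->
        ~ (forall i, position (point C i) (cline C j1)
                   = position (point C i) (cline C j2)) /\
        ~ (forall i, position (point C i) (cline C j1)
                   = - position (point C i) (cline C j2)),
      forall i, ~ (forall j, on_line (cline C j) (point C i))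
    & forall j, ~ (forall i, on_line (cline C j) (point C i))].

(* Main.v *)
Require Import Defs.
From mathcomp Require Import all_boot all_order all_algebra.
From mathcomp Require Import boolp reals.
From mathcomp Require Import all_fingroup zify ring lra.

(* The sign patterns of configurations of parallel lines are those of the
   matrices [s_i - t_j], which have rank at most 2; permutations and signatures
   preserve this bound, and simplicity excludes rank at most 1.  Conversely, a
   rank 2 matrix [B] in the qualitative class has entries [<u_i, v_j>] with
   [u_i], [v_j] in the plane.  Simplicity makes the [u_i] pairwise
   non-proportional, and likewise the [v_j], so a vector is orthogonal to at
   most one vector of the other family.  After a generic shear one may write
   [u_i = d_i (s_i, 1)] and [v_j = e_j (1, - t_j)] with nonzero [d_i], [e_j],
   hence [B i j = d_i e_j (s_i - t_j)], which up to signatures is the pattern of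
   the points [(0, s_i)] and the horizontal lines [y = t_j]. *)

Set Implicit Arguments.
Unset Strict Implicit.
Unset Printing Implicit Defensive.
Import Order.TTheory GRing.Theory Num.Theory.
Local Open Scope ring_scope.

(** * Factorisations and minimum rank *)

Lemma rank_le_factor (F : fieldType) (m n r : nat) (B : 'M[F]_(m, n)) :
  (\rank B <= r)%N -> exists (U : 'M[F]_(m, r)) (V : 'M[F]_(r, n)), B = U *m V.
Proof.
move=> leBr.
(* The middle factor [pid_mx (\rank B)] of the Gaussian decomposition of [B] splits through
   dimension [r], because the rank is at most [r]. *)
exists (col_ebase B *m pid_mx (\rank B)), (pid_mx (\rank B) *m row_ebase B).
rewrite -mulmxA [pid_mx _ *m (_ *m _)]mulmxA mul_pid_mx minnn.
by rewrite (minn_idPr leBr) mulmxA mulmx_ebase.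
Qed.

Lemma rank_rescaled_difference (F : fieldType) (m n : nat)
    (x s : 'I_m -> F) (y t : 'I_n -> F) :
  (\rank (\matrix_(i, j) (x i * y j * (s i - t j))%R) <= 2)%N.
Proof.
pose U : 'M[F]_(m, 2) := \matrix_(i, k) (if k == 0 then x i * s i else - x i).
pose V : 'M[F]_(2, n) := \matrix_(k, j) (if k == 0 then y j else y j * t j).
have -> : \matrix_(i, j) (x i * y j * (s i - t j)) = U *m V.
  apply/matrixP => i j.
  by rewrite !mxE !big_ord_recl big_ord0 !mxE /=; ring.
exact: leq_trans (mxrankM_maxl _ _) (rank_leq_col _).
Qed.

Lemma qual_classP (R : realType) (m n : nat) (A : sign_pattern m n)
    (B : 'M[R]_(m, n)) :
  qual_class A B <-> forall i j, sgz (B i j) = A i j.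
Proof.
split=> [<- i j | AB]; first by rewrite mxE.
by apply: val_inj; apply/matrixP => i j; rewrite mxE AB.
Qed.

(** An upper bound on the rank of the witness is enough, since the lower bound turns it into an
    equality. *)
Lemma min_rank_eq (R : realType) (m n r : nat) (A : sign_pattern m n) :
  min_rank R A = r <->
  (exists2 B : 'M[R]_(m, n), qual_class A B & (\rank B <= r)%N) /\
  (forall B : 'M[R]_(m, n), qual_class A B -> (r <= \rank B)%N).
Proof.
rewrite /min_rank; case: ex_minnP => k /asboolP[B [AB rkB]] minB.
have lek (B' : 'M[R]_(m, n)) : qual_class A B' -> (k <= \rank B')%N.
  by move=> AB'; apply: minB; apply/asboolP; exists B'.
split=> [<- | [[B' AB' leB'r] ler]].
  by split=> //; exists B; rewrite ?rkB.
by apply/eqP; rewrite eqn_leq (leq_trans (lek _ AB') leB'r) -rkB ler.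
Qed.

(** * Positions relative to parallel lines *)

Lemma position_eq0 (R : realType) (p : R * R) (l : line R) :
  (position p l == 0) = on_line l p.
Proof. by rewrite /position; case: on_line => //; case: left_of. Qed.

Lemma position_horizontal (R : realType) (x y b : R) :
  position (x, y) (NonVertical 0 b) = sgz (y - b).
Proof.
rewrite /position /= mul0r add0r -subr_eq0 -subr_gt0.
by case: sgzP.
Qed.

(** Parallel lines are level sets of one affine function: [y - a x] for slope [a], and [- x] for
    vertical lines, since left of an upward line means smaller abscissa. *)
Lemma parallel_position (R : realType) (m n : nat) (C : configuration R m n) :
  (forall j1 j2, parallel (cline C j1) (cline C j2)) ->
  exists (s : 'I_m -> R) (t : 'I_n -> R),
    forall i j, position (point C i) (cline C j) = sgz (s i - t j).
Proof.
move=> par; case: n C par => [|n] C par.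
  by exists (fun=> 0), (fun=> 0) => i [].
case E0: (cline C ord0) => [a b|c].
  exists (fun i => (point C i).2 - a * (point C i).1).
  (* Parallelism to line [ord0] rules out the default value [0]. *)
  exists (fun j => if cline C j is NonVertical _ b then b else 0) => i j.
  have := par ord0 j; rewrite E0 /position.
  case: (cline C j) => //= a' b' <-.
  rewrite -subr_eq0 -subr_gt0 opprD addrA.
  by case: sgzP.
exists (fun i => - (point C i).1).
exists (fun j => if cline C j is Vertical c then - c else 0) => i j.
have := par ord0 j; rewrite E0 /position.
case: (cline C j) => //= c' _.
rewrite opprK addrC eq_sym -subr_eq0 -subr_gt0.
by case: sgzP.
Qed.

(** * Signatures and equivalence of sign patterns *)

Definition unit_sign (x : int) : Prop := x = 1 \/ x = -1.

Lemma sgz_unit_sign (R : realType) (x : R) : x != 0 -> unit_sign (sgz x).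
Proof. by case: sgzP => // _ _; [left | right]. Qed.

Lemma unit_sign_mulxx (x : int) : unit_sign x -> x * x = 1.
Proof. by case=> ->. Qed.

(** Signs are their own inverses and permutations invert, so the equivalence can be solved for [A1];
    this form carries a matrix for [C1] back to [C]. *)
Lemma sp_equivE (m n : nat) (A1 A2 : sign_pattern m n) :
  sp_equiv A1 A2 ->
  exists (s : 'I_m -> 'I_m) (t : 'I_n -> 'I_n) (d : 'I_m -> int)
         (e : 'I_n -> int),
    [/\ forall i, unit_sign (d i), forall j, unit_sign (e j)
      & forall i j, A1 i j = d i * e j * A2 (s i) (t j)].
Proof.
case=> [P1 [D1 [D2 [P2 [/is_perm_mxP[s Es] [/diag_mxP[d1 Ed] nD1]
  [/diag_mxP[d2 Ee] nD2] /is_perm_mxP[t Et] EA]]]]].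
have sign_unit k (D : sign_pattern k k) i : D i i != 0 -> unit_sign (D i i).
  have /mxOverP/(_ i i) := sp_mxP D.
  by rewrite !inE => /or3P[] /eqP ->; [left | right |].
exists (s^-1)%g, t, (fun i => D1 i i), (fun j => D2 j j).
split=> [i|j|i j]; try exact: sign_unit.
have -> : A2 ((s^-1)%g i) (t j) = D1 i i * A1 i j * D2 j j.
  rewrite EA Es Et -(invgK t) -col_permE invgK -!mulmxA -row_permE Ed Ee.
  by rewrite mul_diag_mx mul_mx_diag !mxE permKV permK !eqxx mulrA.
have /unit_sign_mulxx d2E := sign_unit _ _ _ (nD1 i).
have /unit_sign_mulxx e2E := sign_unit _ _ _ (nD2 j).
transitivity ((D1 i i * D1 i i) * (D2 j j * D2 j j) * A1 i j); last by ring.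
by rewrite d2E e2E !mul1r.
Qed.

(** Identity permutations suffice, since the parallel configuration built in the theorem keeps the
    labels of [C]. *)
Lemma sp_equiv_signature (m n : nat) (A1 A2 : sign_pattern m n)
    (d : 'I_m -> int) (e : 'I_n -> int) :
  (forall i, unit_sign (d i)) -> (forall j, unit_sign (e j)) ->
  (forall i j, A2 i j = d i * e j * A1 i j) -> sp_equiv A1 A2.
Proof.
move=> dU eU EA.
have one_sub k : (1%:M : 'M[int]_k) \is a mxOver is_sign.
  by apply/mxOverP => i j; rewrite mxE; case: eqP.
have diag_sub k (f : 'I_k -> int) : (forall i, unit_sign (f i)) ->
    diag_mx (\row_i f i) \is a mxOver is_sign.
  move=> fU; apply/mxOverP => i j; rewrite !mxE.
  by case: eqP => // _; case: (fU i) => ->.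
have diag_sig k (f : 'I_k -> int) (fU : forall i, unit_sign (f i)) :
    signature_pattern (SignPattern (diag_sub k f fU)).
  split=> [|i]; first exact: diag_mx_is_diag.
  by rewrite /= !mxE eqxx; case: (fU i) => ->.
exists (SignPattern (one_sub m)), (SignPattern (diag_sub _ _ dU)).
exists (SignPattern (diag_sub _ _ eU)), (SignPattern (one_sub n)).
split=> //; try exact: is_perm_mx1.
apply/matrixP => i j; rewrite /= mul1mx mulmx1 EA.
by rewrite mul_mx_diag mxE mul_diag_mx !mxE; ring.
Qed.

(** Rescaling by signs preserves zeros. Rows equal or opposite afterwards were equal or opposite
    before, the product of their two signs deciding which; likewise for columns. *)
Lemma simple_conf_signature (R : realType) (m n : nat)
    (C C1 : configuration R m n) (d : 'I_m -> int) (e : 'I_n -> int) :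
  simple_conf C ->
  (forall i, unit_sign (d i)) -> (forall j, unit_sign (e j)) ->
  (forall i j, position (point C1 i) (cline C1 j)
             = d i * e j * position (point C i) (cline C j)) ->
  simple_conf C1.
Proof.
move=> [rowC colC rowC0 colC0] dU eU EC.
have onE i j :
    on_line (cline C1 j) (point C1 i) = on_line (cline C j) (point C i).
  rewrite -!position_eq0 EC.
  by case: (dU i) => ->; case: (eU j) => ->;
    rewrite ?mul1r ?mulN1r ?opprK ?oppr_eq0.
split=> [i1 i2 ne|j1 j2 ne|i on|j on].
- have [neq nopp] := rowC _ _ ne.
  by split=> E; case: (dU i1) => d1; case: (dU i2) => d2;
     (apply: neq + apply: nopp) => j; have := E j; rewrite !EC d1 d2;
     case: (eU j) => ->; lia.
- have [neq nopp] := colC _ _ ne.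
  by split=> E; case: (eU j1) => e1; case: (eU j2) => e2;
     (apply: neq + apply: nopp) => i; have := E i; rewrite !EC e1 e2;
     case: (dU i) => ->; lia.
- by apply: (rowC0 i) => j; rewrite -onE.
- by apply: (colC0 j) => i; rewrite -onE.
Qed.

(** * Simplicity read off a matrix in the qualitative class *)

Section QualitativeClass.
Context (R : realType) (m n : nat) (C : configuration R m n).
Context (B : 'M[R]_(m, n)).
Hypotheses (simpleC : simple_conf C) (CB : qual_class (pattern C) B).

Lemma qual_position i j : position (point C i) (cline C j) = sgz (B i j).
Proof. by move/qual_classP: CB => ->; rewrite /= mxE. Qed.

Lemma qual_on_line i j : on_line (cline C j) (point C i) = (B i j == 0).
Proof. by rewrite -position_eq0 qual_position sgz_eq0. Qed.

Lemma qual_row_neq0 i : ~ (forall j, B i j = 0).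
Proof.
case: simpleC => _ _ row0 _ Bi0.
by apply: (row0 i) => j; rewrite qual_on_line Bi0.
Qed.

Lemma qual_col_neq0 j : ~ (forall i, B i j = 0).
Proof.
case: simpleC => _ _ _ col0 Bj0.
by apply: (col0 j) => i; rewrite qual_on_line Bj0.
Qed.

(** The sign of [c] decides: zero gives a zero row, a positive [c] equal positions, a negative [c]
    opposite positions, all excluded by simplicity. *)
Lemma qual_rows_proportional_eq i1 i2 c :
  (forall j, B i1 j = c * B i2 j) -> i1 = i2.
Proof.
case: simpleC => rowC _ _ _ Bc; apply/eqP/negP => /negP /rowC[neq nopp].
have [c0|/sgz_unit_sign[] c1] := eqVneq c 0.
- by apply: (@qual_row_neq0 i1) => j; rewrite Bc c0 mul0r.
- by apply: neq => j; rewrite !qual_position Bc sgzM c1 mul1r.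
- by apply: nopp => j; rewrite !qual_position Bc sgzM c1 mulN1r.
Qed.

Lemma qual_cols_proportional_eq j1 j2 c :
  (forall i, B i j1 = c * B i j2) -> j1 = j2.
Proof.
case: simpleC => _ colC _ _ Bc; apply/eqP/negP => /negP /colC[neq nopp].
have [c0|/sgz_unit_sign[] c1] := eqVneq c 0.
- by apply: (@qual_col_neq0 j1) => i; rewrite Bc c0 mul0r.
- by apply: neq => i; rewrite !qual_position Bc sgzM c1 mul1r.
- by apply: nopp => i; rewrite !qual_position Bc sgzM c1 mulN1r.
Qed.

(** Rank at most 1 would make any two rows proportional, as none of them vanishes. *)
Lemma qual_rank_ge2 : (2 <= m)%N -> (2 <= \rank B)%N.
Proof.
move=> m2; rewrite leqNgt; apply/negP; rewrite ltnS.
case/rank_le_factor => U [V EB].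
have EBij i j : B i j = U i 0 * V 0 j by rewrite EB mxE big_ord1.
have U0 i : U i 0 != 0.
  by apply/eqP => Ui0; apply: (@qual_row_neq0 i) => j; rewrite EBij Ui0 mul0r.
pose i1 := Ordinal (ltnW m2); pose i2 := Ordinal m2.
suff /(congr1 val) : i1 = i2 by [].
apply: (@qual_rows_proportional_eq _ _ (U i1 0 / U i2 0)) => j.
by rewrite !EBij mulrA divfK.
Qed.

End QualitativeClass.

(** * Vectors in the plane *)

Lemma orthogonal_proportional (F : fieldType) (a b x1 y1 x2 y2 : F) :
  (a, b) != (0, 0) -> (x2, y2) != (0, 0) ->
  a * x1 + b * y1 = 0 -> a * x2 + b * y2 = 0 ->
  exists c, x1 = c * x2 /\ y1 = c * y2.
Proof.
move=> ab0 xy0 E1 E2.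
(* The vectors orthogonal to [(a, b)] form a line, parametrised by the first coordinate if [a = 0]
   and by the second otherwise. *)
have [a0|a0] := eqVneq a 0.
  have b0 : b != 0 by apply: contraNneq ab0 => ->; rewrite a0.
  have y_0 x y : a * x + b * y = 0 -> y = 0.
    by rewrite a0 mul0r add0r => /eqP; rewrite mulf_eq0 (negPf b0) => /eqP.
  have y10 := y_0 _ _ E1; have y20 := y_0 _ _ E2.
  have x20 : x2 != 0 by apply: contraNneq xy0 => ->; rewrite y20.
  by exists (x1 / x2); rewrite divfK // y10 y20 mulr0.
have xE x y : a * x + b * y = 0 -> x = - (b / a) * y.
  move=> E; apply: (mulfI a0); rewrite mulrA mulrN mulrCA mulfV // mulr1 mulNr.
  by apply/eqP; rewrite -addr_eq0 E.
have x1E := xE _ _ E1; have x2E := xE _ _ E2.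
have y20 : y2 != 0.
  by apply: contraNneq xy0 => y20; rewrite x2E y20 mulr0.
by exists (y1 / y2); rewrite x1E x2E mulrCA divfK.
Qed.

Lemma generic_shear (R : realType) (I : finType) (x y : I -> R) :
  (forall i, (x i, y i) != (0, 0)) -> exists c, forall i, c * x i + y i != 0.
Proof.
(* This constant exceeds every [|y i / x i|], so it is never [- (y i / x i)]. Where [x i = 0] the
   summand is [0], by the convention on division, and [y i] is nonzero. *)
move=> xy0; exists (1 + \sum_i `|y i / x i|) => i; apply/negP => /eqP E.
have [x0|x0] := eqVneq (x i) 0.
  by move: (xy0 i) E; rewrite x0 mulr0 add0r => /[swap] ->; rewrite eqxx.
have : 1 + \sum_i `|y i / x i| = - (y i / x i).
  by apply: (mulIf x0); rewrite mulNr divfK //; apply/eqP; rewrite -addr_eq0 E.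
rewrite (bigD1 i) //=.
have : 0 <= \sum_(k | k != i) `|y k / x k| by apply: sumr_ge0.
have := ler_norm (- (y i / x i)); rewrite normrN.
lra.
Qed.

(* The shear [(x, y) |-> (x, y + c x)] on the left factor and its inverse
   transpose on the right factor leave the product unchanged. *)
Lemma factor_rescaled_difference (R : realType) (m n : nat)
    (x1 x2 : 'I_m -> R) (y1 y2 : 'I_n -> R) :
  (forall i, (x1 i, x2 i) != (0, 0)) -> (forall j, (y1 j, y2 j) != (0, 0)) ->
  exists (d s : 'I_m -> R) (e t : 'I_n -> R),
    [/\ forall i, d i != 0, forall j, e j != 0
      & forall i j, x1 i * y1 j + x2 i * y2 j = d i * e j * (s i - t j)].
Proof.
move=> x0 y0.
(* Taking the disjoint union of both families makes a single shear generic for both. *)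
pose f (k : 'I_m + 'I_n) := match k with inl i => x1 i | inr j => - y2 j end.
pose g (k : 'I_m + 'I_n) := match k with inl i => x2 i | inr j => y1 j end.
have [|c cP] := @generic_shear R ('I_m + 'I_n)%type f g.
  case=> [i|j]; first exact: x0.
  by move: (y0 j); rewrite !xpair_eqE oppr_eq0 andbC.
have d0 i : c * x1 i + x2 i != 0 := cP (inl i).
have e0 j : c * - y2 j + y1 j != 0 := cP (inr j).
exists (fun i => c * x1 i + x2 i), (fun i => x1 i / (c * x1 i + x2 i)).
exists (fun j => c * - y2 j + y1 j), (fun j => - (y2 j / (c * - y2 j + y1 j))).
split=> // i j.
by field; rewrite e0 d0.
Qed.

Theorem theorem2p3 (R : realType) (m n : nat) (C : configuration R m n)
    (simpleC : simple_conf C) :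
  min_rank R (pattern C) = 2%N <->
  [/\ (2 <= m)%N /\ (2 <= n)%N,
      (forall (i : 'I_m) (j1 j2 : 'I_n),
         on_line (cline C j1) (point C i) ->
         on_line (cline C j2) (point C i) -> j1 = j2) /\
      (forall (j : 'I_n) (i1 i2 : 'I_m),
         on_line (cline C j) (point C i1) ->
         on_line (cline C j) (point C i2) -> i1 = i2)
    & exists C1 : configuration R m n,
        [/\ simple_conf C1, conf_equiv C C1
          & forall j1 j2 : 'I_n, parallel (cline C1 j1) (cline C1 j2)]].
Proof.
rewrite min_rank_eq; split; last first.
  case=> [[m2 _] _ [C1 [_ /sp_equivE[s [t [d [e [dU eU EA]]]]]]]].
  case/parallel_position => p [q EC1].
  split; last by move=> B CB; apply: qual_rank_ge2 simpleC CB m2.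
  (* The difference matrix of the parallel lines of [C1], relabelled and rescaled to fit the pattern
     of [C]. *)
  exists (\matrix_(i, j) ((d i)%:~R * (e j)%:~R * (p (s i) - q (t j))));
    last first.
    exact: rank_rescaled_difference.
  apply/qual_classP => i j; rewrite EA mxE !sgzM !sgz_int [in RHS]/= mxE EC1.
  by case: (dU i) => ->; case: (eU j) => ->.
case=> [[B CB leB2] geB2].
have rkB : \rank B = 2%N by apply/eqP; rewrite eqn_leq leB2 geB2.
have [U [V EB]] := rank_le_factor leB2.
have EBij i j : B i j = U i 0 * V 0 j + U i 1 * V 1 j.
  rewrite EB mxE !big_ord_recl big_ord0 addr0.
  by congr (_ + U _ _ * V _ _); apply: val_inj.
have U0 i : (U i 0, U i 1) != (0, 0).
  apply/eqP => -[u0 u1]; apply: (qual_row_neq0 simpleC CB (i := i)) => j.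
  by rewrite EBij u0 u1 !mul0r addr0.
have V0 j : (V 0 j, V 1 j) != (0, 0).
  apply/eqP => -[v0 v1]; apply: (qual_col_neq0 simpleC CB (j := j)) => i.
  by rewrite EBij v0 v1 !mulr0 addr0.
split.
- by split; rewrite -rkB ?rank_leq_row ?rank_leq_col.
(* Two right vectors orthogonal to the same left vector are proportional, hence so are the
   corresponding columns of [B]; the second half exchanges the two families. *)
- split=> [i j1 j2|j i1 i2];
    rewrite !(qual_on_line CB) !EBij => /eqP E1 /eqP E2.
    have [c [c0 c1]] := orthogonal_proportional (U0 i) (V0 j2) E1 E2.
    apply: (qual_cols_proportional_eq simpleC CB (c := c)) => k.
    by rewrite !EBij c0 c1; ring.
  move: E1 E2; rewrite ![U _ _ * _]mulrC => E1 E2.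
  have [c [c0 c1]] := orthogonal_proportional (V0 j) (U0 i2) E1 E2.
  apply: (qual_rows_proportional_eq simpleC CB (c := c)) => k.
  by rewrite !EBij c0 c1; ring.
have [d [s [e [t [d0 e0 EUV]]]]] := factor_rescaled_difference U0 V0.
pose C1 := Configuration (fun i => (0, s i)) (fun j => NonVertical 0 (t j)).
have dU i := sgz_unit_sign (d0 i); have eU j := sgz_unit_sign (e0 j).
have EC1 i j : position (point C1 i) (cline C1 j)
    = sgz (d i) * sgz (e j) * position (point C i) (cline C j).
  rewrite (qual_position CB) EBij EUV position_horizontal !sgzM.
  (* The signs of [d i] and [e j] now occur squared and cancel. *)
  have /unit_sign_mulxx dd := dU i; have /unit_sign_mulxx ee := eU j.
  transitivity (sgz (d i) * sgz (d i) * (sgz (e j) * sgz (e j))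
                * sgz (s i - t j)).
    by rewrite dd ee !mul1r.
  by ring.
exists C1; split=> //.
- exact: simple_conf_signature simpleC dU eU EC1.
- by apply: sp_equiv_signature dU eU _ => i j; rewrite /= !mxE EC1.
Qed.
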